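(* Let $n=\sum_{i=1}^Nn_i$ with $n_i\in\mathbb{N}$, let $Q\in\mathbb{R}^{n\times n}$ with $Q=Q^T\succ0$, let $r\in\mathbb{R}^n$, and let $A=\mathrm{diag}(\alpha_1I_{n_1},\dots,\alpha_NI_{n_N})$ with $\alpha_i>0$ for all $i$. Let $\hat x=-Q^{-1}r$ and $\hat x_A=-(Q+A)^{-1}r$. Then the regularization error $e_A:=\|\hat x-\hat x_A\|_2$ satisfies $$e_A\le\frac{\|r\|_2k_Q^2\alpha_{max}}{\|Q\|_2^2+\|Q\|_2k_Q\alpha_{max}},$$ where $\alpha_{max}:=\max_i\alpha_i$.
   Context: $\|\cdot\|_2$ is the Euclidean norm on vectors and the spectral norm on matrices. $k_Q=\lambda_1(Q)/\lambda_n(Q)$ is the ratio of the largest to the smallest eigenvalue of $Q$. $\hat x$ and $\hat x_A$ are the solutions of the unregularized and regularized quadratic programs with objectives $\frac12x^TQx+r^Tx$ and $\frac12x^T(Q+A)x+r^Tx$, respectively. *)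

(* Defs.v *)
From mathcomp Require Import all_boot all_order all_algebra.
From mathcomp Require Import boolp classical_sets reals.

Set Implicit Arguments.
Unset Strict Implicit.
Unset Printing Implicit Defensive.

Import Order.TTheory GRing.Theory Num.Theory.
Local Open Scope ring_scope.

Definition l2norm (R : realType) (n : nat) (x : 'cV[R]_n) : R :=
  Num.sqrt (\sum_(i < n) x i 0 ^+ 2).

(* The matrix norm induced by the Euclidean norm; the set is nonempty and
   bounded, so [sup] is a genuine supremum. *)
Definition spectral_norm (R : realType) (m n : nat) (M : 'M[R]_(m, n)) : R :=
  sup [set l2norm (M *m x) | x in [set x : 'cV[R]_n | l2norm x <= 1]]%classic.

(* A matrix has finitely many eigenvalues, so [sup] and [inf] are a maximum and
   a minimum whenever some real eigenvalue exists, in particular for symmetric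
   matrices of positive size. *)
Definition lambda_max (R : realType) (n : nat) (M : 'M[R]_n) : R :=
  sup [set a | eigenvalue M a]%classic.

Definition lambda_min (R : realType) (n : nat) (M : 'M[R]_n) : R :=
  inf [set a | eigenvalue M a]%classic.

Definition eigen_ratio (R : realType) (n : nat) (M : 'M[R]_n) : R :=
  lambda_max M / lambda_min M.

Definition posdefmx (R : realType) (n : nat) (M : 'M[R]_n) : Prop :=
  forall x : 'cV[R]_n, x != 0 -> 0 < (x^T *m M *m x) 0 0.

(* Main.v *)
Require Import Defs.
From mathcomp Require Import all_boot all_order all_algebra.
From mathcomp Require Import boolp classical_sets reals ring lra.

(** Write [l], [L] for the extreme eigenvalues of [Q] and [a] for the largest
    [alpha i]. Since [||Q|| <= L] and [k = L / l], the right-hand side is at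
    least [|r| a / (l (l + a))]. The error is [|D r|] with
    [D = Q^-1 - (Q + A)^-1] symmetric, so it is enough that
    [0 <= D <= a / (l (l + a))] in the Loewner order; bounding the norm of
    [D = Q^-1 A (Q + A)^-1] factor by factor would be too weak. *)

Set Implicit Arguments.
Unset Strict Implicit.
Unset Printing Implicit Defensive.

Import Order.TTheory GRing.Theory Num.Theory.
Local Open Scope ring_scope.

(** * Inner product and Euclidean norm *)

Definition dot (R : realType) (n : nat) (u v : 'cV[R]_n) : R :=
  (u^T *m v) 0 0.

Section Dot.
Variables (R : realType) (n : nat).
Implicit Types (u v x : 'cV[R]_n) (M : 'M[R]_n) (c : R).

Lemma dotE u v : dot u v = \sum_i u i 0 * v i 0.
Proof. by rewrite /dot mxE; apply: eq_bigr => i _; rewrite mxE. Qed.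

Lemma dotC u v : dot u v = dot v u.
Proof. by rewrite !dotE; apply: eq_bigr => i _; rewrite mulrC. Qed.

Lemma dotDr u v x : dot u (v + x) = dot u v + dot u x.
Proof. by rewrite /dot mulmxDr mxE. Qed.

Lemma dotDl u v x : dot (u + v) x = dot u x + dot v x.
Proof. by rewrite !(dotC _ x) dotDr. Qed.

Lemma dotZr c u v : dot u (c *: v) = c * dot u v.
Proof. by rewrite /dot -scalemxAr mxE. Qed.

Lemma dotZl c u v : dot (c *: u) v = c * dot u v.
Proof. by rewrite !(dotC _ v) dotZr. Qed.

Lemma dotNr u v : dot u (- v) = - dot u v.
Proof. by rewrite -scaleN1r dotZr mulN1r. Qed.

Lemma dotNl u v : dot (- u) v = - dot u v.
Proof. by rewrite !(dotC _ v) dotNr. Qed.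

Lemma dot_mulmx M u v : dot (M *m u) v = dot u (M^T *m v).
Proof. by rewrite /dot trmx_mul mulmxA. Qed.

Lemma dot_ge0 x : 0 <= dot x x.
Proof. by rewrite dotE sumr_ge0 // => i _; rewrite -expr2 sqr_ge0. Qed.

Lemma dot_eq0 x : (dot x x == 0) = (x == 0).
Proof.
apply/idP/eqP => [|->]; last by rewrite /dot mulmx0 mxE.
rewrite dotE psumr_eq0 => [/allP h|i _]; last by rewrite -expr2 sqr_ge0.
apply/colP => i; rewrite mxE; apply/eqP.
by have := h i (mem_index_enum _); rewrite -expr2 sqrf_eq0.
Qed.

Lemma dot_gt0 x : x != 0 -> 0 < dot x x.
Proof. by move=> x0; rewrite lt_neqAle dot_ge0 andbT eq_sym dot_eq0. Qed.

Lemma l2normE x : l2norm x = Num.sqrt (dot x x).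
Proof. by rewrite /l2norm dotE. Qed.

Lemma l2norm_le c u v : 0 <= c -> dot u u <= c ^+ 2 * dot v v ->
  l2norm u <= c * l2norm v.
Proof.
move=> c0 h; rewrite !l2normE -[X in _ <= X * _](ger0_norm c0) -sqrtr_sqr.
rewrite -sqrtrM ?sqr_ge0 //.
exact: ler_wsqrtr.
Qed.

(** * Bounds on quadratic forms *)

(** Each product [x i 0 * x j 0] is at most [dot x x] in absolute value, so the entries of [M] sum
    to a crude bound. The extra 1 keeps [K] positive even for [M = 0]. *)
Lemma quad_form_bounded M :
  exists2 K, 0 < K & forall x, dot x (M *m x) <= K * dot x x.
Proof.
exists (1 + \sum_i \sum_j `|M i j|) => [|x].
  by rewrite ltr_pwDl // sumr_ge0 // => i _; rewrite sumr_ge0.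
have sq_le i : x i 0 ^+ 2 <= dot x x.
  rewrite dotE (bigD1 i) //= -expr2 lerDl sumr_ge0 // => j _.
  by rewrite -expr2 sqr_ge0.
have prod_le i j : `|x i 0 * x j 0| <= dot x x.
  have := sq_le i; have := sq_le j; have := sqr_ge0 (x i 0 + x j 0).
  by have := sqr_ge0 (x i 0 - x j 0); rewrite ler_norml; lra.
rewrite mulrDl mul1r.
apply: (@le_trans _ _ ((\sum_i \sum_j `|M i j|) * dot x x)).
  rewrite dotE mulr_suml ler_sum // => i _.
  rewrite mxE mulr_sumr mulr_suml ler_sum // => j _.
  rewrite mulrCA (le_trans (ler_norm _)) // normrM.
  by rewrite ler_wpM2l.
by rewrite lerDr dot_ge0.
Qed.

(* Expand the form at [x - c^-1 M x]. *)
Lemma psd_mulmx_le M c : M^T = M -> 0 < c ->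
  (forall x, 0 <= dot x (M *m x)) ->
  (forall x, dot x (M *m x) <= c * dot x x) ->
  forall x, dot (M *m x) (M *m x) <= c * dot x (M *m x).
Proof.
move=> Ms c0 M0 Mc x.
have := M0 (x - c^-1 *: (M *m x)); have := Mc (M *m x).
rewrite mulmxBr -scalemxAr !(dotDl, dotDr, dotNl, dotNr, dotZl, dotZr).
have -> : dot x (M *m (M *m x)) = dot (M *m x) (M *m x) by rewrite dot_mulmx Ms.
set y := dot _ (M *m (M *m x)); set z := dot (M *m x) _ => h1 h2.
have : c^-1 * (c^-1 * y) <= c^-1 * z.
  by rewrite ler_pM2l ?invr_gt0 // ler_pdivrMl.
move=> h3; rewrite -ler_pdivrMl //; lra.
Qed.

(** On a kernel vector the form vanishes, so coercivity makes the vector zero. The transposes are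
    there because [row_free] concerns row vectors. *)
Lemma coercive_unitmx M c : 0 < c ->
  (forall x, c * dot x x <= dot x (M *m x)) -> M \in unitmx.
Proof.
move=> c0 h; rewrite -unitmx_tr -row_free_unit.
apply: inj_row_free => v /(congr1 trmx); rewrite trmx_mul trmxK trmx0 => Mv.
have := h v^T; rewrite Mv [dot _ 0]/dot mulmx0 mxE pmulr_rle0 // => v0.
apply: trmx_inj; rewrite trmx0; apply/eqP.
by rewrite -dot_eq0 eq_le v0 dot_ge0.
Qed.

(** * Extreme eigenvalues of symmetric matrices *)

Lemma sym_eigenvalueP M a : M^T = M ->
  reflect (exists2 v : 'cV_n, M *m v = a *: v & v != 0) (eigenvalue M a).
Proof.
move=> Ms; apply: (iffP eigenvalueP) => -[v Mv v0]; exists v^T.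
- by rewrite -{1}Ms -trmx_mul Mv linearZ.
- by rewrite -(inj_eq (@trmx_inj _ _ _)) trmxK trmx0.
- by rewrite -{1}Ms -trmx_mul Mv linearZ.
- by rewrite -(inj_eq (@trmx_inj _ _ _)) trmxK trmx0.
Qed.


Lemma ex_nonzero : (0 < n)%N -> exists x : 'cV[R]_n, x != 0.
Proof.
move=> n0; exists (const_mx 1); apply/eqP => /colP /(_ (Ordinal n0)) /eqP.
by rewrite !mxE oner_eq0.
Qed.

(* The largest [m] with [m |x|^2 <= x^T M x] is an eigenvalue: if [M - m] were
   invertible, then [|x|^2 <= K |(M - m) x|^2 <= K C x^T (M - m) x], and [m]
   could be increased by [1 / (K C)]. *)
Lemma rayleigh_min M : (0 < n)%N -> M^T = M ->
  exists2 m, eigenvalue M m & forall x, m * dot x x <= dot x (M *m x).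
Proof.
move=> n0 Ms.
pose S := [set c | forall x, c * dot x x <= dot x (M *m x)]%classic.
have S0 : (S !=set0)%classic.
  have [K _ hK] := quad_form_bounded (- M).
  exists (- K) => x; have := hK x.
  by rewrite mulNmx dotNr mulNr; lra.
have SP c x : x != 0 -> S c -> c <= dot x (M *m x) / dot x x.
  by move=> x0 Sc; rewrite ler_pdivlMr ?dot_gt0.
have Sub : has_ubound S.
  have [e e0] := ex_nonzero n0.
  by exists (dot e (M *m e) / dot e e) => c; apply: SP.
set m := sup S.
(* Every Rayleigh quotient bounds [S] from above, hence is at least [m]: the supremum is
   attained. *)
have Sm : S m.
  move=> x; have [->|x0] := eqVneq x 0.
    by rewrite mulmx0 /dot mulmx0 mxE mulr0.
  rewrite -ler_pdivlMr ?dot_gt0 //; apply: ge_sup => // c; exact: SP.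
exists m => //; apply: contrapT => /negP.
rewrite /eigenvalue negbK kermx_eq0 row_free_unit => Wu.
set W := M - m%:M in Wu.
have WE x : dot x (W *m x) = dot x (M *m x) - m * dot x x.
  by rewrite mulmxBl mul_scalar_mx dotDr dotNr dotZr.
have Ws : W^T = W by rewrite /W linearB /= Ms tr_scalar_mx.
have W0 x : 0 <= dot x (W *m x) by rewrite WE subr_ge0.
have [C C0 hC] := quad_form_bounded W.
(* Applied at [W *m x], this form is the squared norm of [x], which gives
   [dot x x <= K * dot (W *m x) (W *m x)]. *)
have [K K0 hK] := quad_form_bounded ((invmx W)^T *m invmx W).
have: S (m + (K * C)^-1).
  move=> x; rewrite mulrDl -lerBrDl -WE mulrC ler_pdivrMr ?mulr_gt0 //.
  have := hK (W *m x); rewrite -mulmxA -dot_mulmx mulKmx //.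
  move=> /le_trans; apply; rewrite [leRHS]mulrC -mulrA ler_pM2l //.
  by rewrite psd_mulmx_le.
move/(ub_le_sup Sub); rewrite -/m gerDl.
by rewrite leNgt invr_gt0 mulr_gt0.
Qed.

(** Testing the Rayleigh bound on an eigenvector shows that no eigenvalue lies below [m]; as [m] is
    itself one, the infimum is attained there. *)
Lemma lambda_minP M : (0 < n)%N -> M^T = M ->
  eigenvalue M (lambda_min M) /\
  forall x, lambda_min M * dot x x <= dot x (M *m x).
Proof.
move=> n0 Ms; have [m em hm] := rayleigh_min n0 Ms.
suff -> : lambda_min M = m by [].
have lb : lbound [set a | eigenvalue M a]%classic m.
  move=> a /(sym_eigenvalueP _ Ms) [v Mv v0].
  by have := hm v; rewrite Mv dotZr ler_pM2r ?dot_gt0.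
apply/eqP; rewrite eq_le lb_le_inf ?andbT //; last by exists m.
by apply: ge_inf => //; exists m.
Qed.

Lemma lambda_maxE M : lambda_max M = - lambda_min (- M).
Proof.
have eN a : eigenvalue (- M) a = eigenvalue M (- a).
  apply/eigenvalueP/eigenvalueP => -[v Mv v0]; exists v => //.
    by rewrite scaleNr -Mv mulmxN opprK.
  by rewrite mulmxN Mv scaleNr opprK.
rewrite /lambda_min /inf opprK; congr sup; apply/seteqP; split => a /=.
  by move=> ea; exists (- a); rewrite ?opprK //= eN opprK.
by move=> [b eb <-]; rewrite -eN.
Qed.

Lemma lambda_maxP M : (0 < n)%N -> M^T = M ->
  eigenvalue M (lambda_max M) /\
  forall x, dot x (M *m x) <= lambda_max M * dot x x.
Proof.
move=> n0 Ms; have NMs : (- M)^T = - M by rewrite linearN /= Ms.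
have [e h] := lambda_minP n0 NMs; rewrite lambda_maxE; split.
  move/(sym_eigenvalueP _ NMs): e => [v Mv v0]; apply/(sym_eigenvalueP _ Ms).
  by exists v => //; rewrite scaleNr -Mv mulNmx opprK.
by move=> x; have := h x; rewrite mulNmx dotNr; lra.
Qed.

(** * Spectral norm and perturbation of the inverse *)

Lemma spectral_norm_le M c : 0 <= c ->
  (forall x, l2norm (M *m x) <= c * l2norm x) -> spectral_norm M <= c.
Proof.
move=> c0 h; apply: ge_sup.
  exists (l2norm (M *m 0)); exists 0 => //=.
  by rewrite l2normE /dot mulmx0 mxE sqrtr0 ler01.
by move=> _ [x /= x1 <-]; rewrite (le_trans (h x)) // ler_piMr.
Qed.

Lemma spectral_norm_gt0 M : (0 < n)%N -> M \in unitmx -> 0 < spectral_norm M.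
Proof.
move=> n0 Mu; have [x x0] := ex_nonzero n0.
pose u := (Num.sqrt (dot x x))^-1 *: x.
have u1 : dot u u = 1.
  rewrite dotZl dotZr mulrA -expr2 exprVn sqr_sqrtr ?dot_ge0 //.
  by rewrite mulVf // dot_eq0.
have Mu0 : M *m u != 0.
  apply: contra_eq_neq u1 => /(congr1 (mulmx (invmx M))).
  rewrite mulKmx // => ->; by rewrite mulmx0 /dot mulmx0 mxE eq_sym oner_eq0.
apply: (@lt_le_trans _ _ (l2norm (M *m u))).
  by rewrite l2normE sqrtr_gt0 dot_gt0.
apply: ub_le_sup; last by exists u => //=; rewrite l2normE u1 sqrtr1.
(* A supremum dominates its members only if the set is bounded above. The bound [1 + K] works
   without a square root because [K <= (1 + K) ^+ 2]. *)
have [K K0 hK] := quad_form_bounded (M^T *m M).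
exists (1 + K) => _ [y /= y1 <-].
have K1 : 0 <= 1 + K by rewrite addr_ge0 // ltW.
apply: (@le_trans _ _ ((1 + K) * l2norm y)); last by rewrite ler_piMr.
apply: l2norm_le => //; rewrite dot_mulmx mulmxA.
rewrite (le_trans (hK y)) // ler_wpM2r ?dot_ge0 //; nra.
Qed.

(* With [t = l / (l + a)], bounding [r^T (Q + A)^-1 r] below by its variational
   value at [t Q^-1 r] gives
   [Q^-1 - (Q + A)^-1 <= a / (l (l + a))] in the Loewner order. *)
Lemma invmx_perturbation Q A l a (r : 'cV[R]_n) :
  Q^T = Q -> A^T = A -> 0 < l -> 0 < a ->
  (forall x, l * dot x x <= dot x (Q *m x)) ->
  (forall x, 0 <= dot x (A *m x)) ->
  (forall x, dot x (A *m x) <= a * dot x x) ->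
  l2norm (invmx Q *m r - invmx (Q + A) *m r) <= a / (l * (l + a)) * l2norm r.
Proof.
move=> Qs As l0 a0 Ql A0 Aa.
have la0 : 0 < l + a by rewrite addr_gt0.
have Qu : Q \in unitmx by apply: (coercive_unitmx l0).
have QAl x : l * dot x x <= dot x ((Q + A) *m x).
  by rewrite mulmxDl dotDr (le_trans (Ql x)) // lerDl.
have QAu : Q + A \in unitmx by apply: (coercive_unitmx l0).
set c := a / _.
have c0 : 0 < c by rewrite divr_gt0 // mulr_gt0.
pose D := invmx Q - invmx (Q + A).
have Ds : D^T = D by rewrite /D linearB /= !trmx_inv linearD /= Qs As.
have Qsw x y : dot y (Q *m x) = dot x (Q *m y) by rewrite dotC dot_mulmx Qs.
have Asw x y : dot y (A *m x) = dot x (A *m y) by rewrite dotC dot_mulmx As.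
have Q0 x : 0 <= dot x (Q *m x).
  by rewrite (le_trans _ (Ql x)) // mulr_ge0 ?dot_ge0 // ltW.
(* The difference [dot x y - dot x z] equals the form of [Q] at [y - z] plus the form of [A] at
   [z]. *)
have D0 x : 0 <= dot x (D *m x).
  rewrite mulmxBl dotDr dotNr subr_ge0.
  set y := invmx Q *m x; set z := invmx (Q + A) *m x.
  have xy : x = Q *m y by rewrite mulKVmx.
  have xz : x = Q *m z + A *m z by rewrite -mulmxDl mulKVmx.
  have e1 : dot x y = dot y (Q *m y) by rewrite dotC {1}xy.
  have e2 : dot x z = dot y (Q *m z) by rewrite dotC {1}xy Qsw.
  have e3 : dot x z = dot z (Q *m z) + dot z (A *m z).
    by rewrite dotC {1}xz dotDr.
  have := Q0 (y - z); have := A0 z.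
  rewrite mulmxBr !(dotDl, dotDr, dotNl, dotNr).
  rewrite (Qsw y z); lra.
have Dc x : dot x (D *m x) <= c * dot x x.
  rewrite mulmxBl dotDr dotNr.
  set y := invmx Q *m x; set z := invmx (Q + A) *m x.
  (* This [t] minimizes [(1 - t) ^+ 2 + a * t ^+ 2 / l], the factor of [q] that remains below once
     [p <= q / l]; the minimum is [a / (l + a)]. *)
  pose t := l / (l + a); pose w := t *: y.
  have xy : x = Q *m y by rewrite mulKVmx.
  have xz : x = Q *m z + A *m z by rewrite -mulmxDl mulKVmx.
  have e1 : dot x y = dot y (Q *m y) by rewrite dotC {1}xy.
  have e3 : dot x z = dot z (Q *m z) + dot z (A *m z).
    by rewrite dotC {1}xz dotDr.
  have e4 : dot x w = dot w (Q *m z) + dot w (A *m z).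
    by rewrite dotC {1}xz dotDr.
  have e5 : dot x w = t * dot y (Q *m y) by rewrite dotZr e1.
  (* Nonnegativity of the form of [Q + A] at [z - w], followed by [A <= a] at [w]. *)
  have h1 : 2 * dot x w - dot w (Q *m w) - a * dot w w <= dot x z.
    have := Q0 (z - w); have := A0 (z - w); have := Aa w.
    rewrite !mulmxBr !(dotDl, dotDr, dotNl, dotNr) (Qsw w z) (Asw w z).
    lra.
  (* The square of [x - l *: y] is nonnegative, and coercivity bounds its term
     [l ^+ 2 * dot y y]. *)
  have h3 : l * dot y (Q *m y) <= dot x x.
    have := dot_ge0 (x - l *: y).
    rewrite !(dotDl, dotDr, dotNl, dotNr, dotZl, dotZr).
    rewrite (dotC y x) e1 => h.
    have : l * (l * dot y y) <= l * dot y (Q *m y) by rewrite ler_pM2l.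
    lra.
  set q := dot y (Q *m y) in e1 e5 h3; set p := dot y y.
  have h4 : l * p <= q by exact: Ql.
  have e6 : dot w (Q *m w) = t ^+ 2 * q.
    by rewrite /w -scalemxAr dotZl dotZr mulrA.
  have e7 : dot w w = t ^+ 2 * p by rewrite dotZl dotZr mulrA.
  rewrite e1; move: h1; rewrite e5 e6 e7 => h1.
  apply: (@le_trans _ _ ((1 - t) ^+ 2 * q + a * t ^+ 2 * p)); first by lra.
  (* Over a common denominator the numerators compare term by term, through [l * (l * p) <= dot x x]
     and [l * q <= dot x x]. *)
  have -> : c * dot x x =
      (l * a * dot x x + a ^+ 2 * dot x x) / (l * (l + a) ^+ 2).
    rewrite /c; field; rewrite !gt_eqF //.
  have -> : (1 - t) ^+ 2 * q + a * t ^+ 2 * p =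
      (a * l * (l * (l * p)) + a ^+ 2 * (l * q)) / (l * (l + a) ^+ 2).
    rewrite /t; field; rewrite !gt_eqF //.
  rewrite ler_pM2r ?invr_gt0 ?mulr_gt0 ?exprn_gt0 //.
  have h5 : l * (l * p) <= dot x x.
    by rewrite (le_trans _ h3) // ler_pM2l.
  by rewrite (mulrC l a) lerD // ler_pM2l ?mulr_gt0 ?exprn_gt0.
have -> : invmx Q *m r - invmx (Q + A) *m r = D *m r by rewrite mulmxBl.
apply: l2norm_le; first exact: ltW.
rewrite (le_trans (psd_mulmx_le Ds c0 D0 Dc r)) // expr2 -mulrA ler_pM2l //.
Qed.

End Dot.

(** * Block-diagonal regularizer and the error bound *)

(** Used both for [A] and for [a%:M - A], which has the same block shape; the second use gives
    [A <= a]. *)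
Lemma mxdiag_scalar_form_ge0 (R : realType) (N : nat) (n_ : 'I_N -> nat)
    (c : 'I_N -> R) (x : 'cV[R]_(\sum_(i < N) n_ i)) :
  (forall i, 0 <= c i) ->
  0 <= dot x (\mxdiag_(i < N) ((c i)%:M : 'M[R]_(n_ i)) *m x).
Proof.
move=> c0; rewrite -(submxcolK x) mul_mxdiag_mxcol {1}/dot tr_mxcol.
rewrite mul_mxrow_mxcol summxE sumr_ge0 // => i _.
by rewrite mul_scalar_mx -scalemxAr mxE mulr_ge0 // -/(dot _ _) dot_ge0.
Qed.

Theorem theorem6 (R : realType) (N : nat) (n_ : 'I_N -> nat)
    (Q : 'M[R]_(\sum_(i < N) n_ i)) (r : 'cV[R]_(\sum_(i < N) n_ i))
    (alpha : 'I_N -> R)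
    (Qsym : Q^T = Q) (Qpos : posdefmx Q)
    (alpha_gt0 : forall i, 0 < alpha i) :
  let A : 'M[R]_(\sum_(i < N) n_ i) :=
    \mxdiag_(i < N) ((alpha i)%:M : 'M[R]_(n_ i)) in
  (* all alpha i are positive, so the seed 0 does not affect the maximum *)
  let alpha_max : R := \big[Num.max/0]_(i < N) alpha i in
  let xhat := - (invmx Q *m r) in
  let xhatA := - (invmx (Q + A) *m r) in
  let eA := l2norm (xhat - xhatA) in
  is_true (eA <= (l2norm r * eigen_ratio Q ^+ 2 * alpha_max)
        / (spectral_norm Q ^+ 2 + spectral_norm Q * eigen_ratio Q * alpha_max)).
Proof.
move=> A a xhat xhatA eA.
(* In dimension 0 there are no eigenvalues, and both sides vanish because all norms are 0. *)
have [n0|] := posnP (\sum_(i < N) n_ i)%N.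
  have l2norm0 (x : 'cV[R]_(\sum_(i < N) n_ i)) : l2norm x = 0.
    rewrite /l2norm big1 ?sqrtr0 // => i _.
    by move: (ltn_ord i); rewrite {2}n0.
  by rewrite /eA !l2norm0 !mul0r.
move=> n0.
(* Positive dimension forces at least one block, so the maximum exceeds its seed 0. *)
have a0 : 0 < a.
  case: (posnP N) => [N0|N0]; last first.
    exact: lt_le_trans (alpha_gt0 (Ordinal N0)) (le_bigmax _ _ _).
  by move: n0; rewrite big1 // => i _; move: (ltn_ord i); rewrite {2}N0.
have Qgt0 x : x != 0 -> 0 < dot x (Q *m x).
  by move=> x0; rewrite /dot mulmxA; apply: Qpos.
have ev_gt0 b : eigenvalue Q b -> 0 < b.
  case/(sym_eigenvalueP _ Qsym) => v Qv v0.
  by have := Qgt0 v v0; rewrite Qv dotZr pmulr_lgt0 ?dot_gt0.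
have [el hl] := lambda_minP n0 Qsym; have [eL hL] := lambda_maxP n0 Qsym.
move: el eL hl hL => /ev_gt0 + /ev_gt0; rewrite /eigen_ratio.
set l := lambda_min Q; set L := lambda_max Q => l0 L0 hl hL.
have Q0 x : 0 <= dot x (Q *m x).
  by rewrite (le_trans _ (hl x)) // mulr_ge0 ?dot_ge0 // ltW.
have sL : spectral_norm Q <= L.
  apply: spectral_norm_le => [|x]; first exact: ltW.
  apply: l2norm_le; first exact: ltW.
  by rewrite (le_trans (psd_mulmx_le Qsym L0 Q0 hL x)) // expr2 -mulrA ler_pM2l.
have s0 : 0 < spectral_norm Q.
  by apply: spectral_norm_gt0 (coercive_unitmx l0 hl).
set s := spectral_norm Q in sL s0 *.
have As : A^T = A.
  by rewrite tr_mxdiag; apply: eq_mxdiag => i; rewrite tr_scalar_mx.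
have A0 x : 0 <= dot x (A *m x).
  by apply: mxdiag_scalar_form_ge0 => i; apply: ltW.
have Aa x : dot x (A *m x) <= a * dot x x.
  have : 0 <= dot x (\mxdiag_(i < N) ((a - alpha i)%:M : 'M[R]_(n_ i)) *m x).
    by apply: mxdiag_scalar_form_ge0 => i; rewrite subr_ge0 le_bigmax.
  under eq_mxdiag do rewrite raddfB.
  by rewrite mxdiagB mxdiagZ mulmxBl mul_scalar_mx dotDr dotNr dotZr subr_ge0.
have -> : eA = l2norm (invmx Q *m r - invmx (Q + A) *m r).
  by rewrite /eA /xhat /xhatA -opprD /l2norm; congr Num.sqrt;
    apply: eq_bigr => i _; rewrite mxE sqrrN.
apply: le_trans (invmx_perturbation r Qsym As l0 a0 hl A0 Aa) _.
set k := L / l.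
have k0 : 0 < k by rewrite divr_gt0.
rewrite mulrC -!(mulrA (l2norm r)) ler_wpM2l ?sqrtr_ge0 //.
(* The perturbation constant is exactly the claimed bound with [L] in place of [s]. What remains is
   that shrinking [L] to [s > 0] shrinks the denominator. *)
have -> : a / (l * (l + a)) = k ^+ 2 * a / (L ^+ 2 + L * k * a).
  by rewrite /k; field; rewrite !gt_eqF ?addr_gt0 ?mulr_gt0.
clearbody k.
rewrite ler_pM2l ?mulr_gt0 ?exprn_gt0 //.
rewrite lef_pV2 ?posrE ?addr_gt0 ?mulr_gt0 ?exprn_gt0 //.
rewrite lerD ?lerXn2r ?nnegrE ?(ltW s0) ?(ltW L0) //.
by rewrite !ler_pM2r.
Qed.
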